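(* Let $u$ be a primitive word over $\{a,b\}$, let $k\ge2$ be an integer, and let $w=u^k$. Then $w$ is factor-symmetric if and only if $u$ is a conjugate of some Christoffel word.
   Context: Words are finite words over $\{a,b\}$; a factor of $w$ is a contiguous subword (including the empty word and $w$ itself). A word $w$ of length $n$ is factor-symmetric if for every $0\le i\le n$, the number of distinct factors of $w$ of length $i$ equals the number of distinct factors of $w$ of length $n-i$. A word is primitive if it is not equal to $v^m$ for any word $v$ and integer $m\ge 2$. Two words are conjugate if they can be written $xy$ and $yx$ for some words $x,y$. A palindrome is a word equal to its reversal. A Christoffel word is either $a$, or $b$, or a word $c=amb$ or $c=bma$ with $m$ a palindrome and $c$ a product of two palindromes. *)

(* Defs.v *)
From mathcomp Require Import all_boot.

Set Implicit Arguments.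
Unset Strict Implicit.
Unset Printing Implicit Defensive.

(* The two-letter alphabet {a, b} is encoded by bool. *)
Notation letter := bool.
Notation word := (seq letter).
Definition la : letter := false.
Definition lb : letter := true.

Definition wpow (v : word) (m : nat) : word := flatten (nseq m v).

(* The number of distinct factors, not of their occurrences: [infix v w] tests
   whether v is a contiguous subword of w. *)
Definition nb_factors (w : word) (i : nat) : nat :=
  #|[set v : i.-tuple letter | infix v w]|.

Definition factor_symmetric (w : word) : Prop :=
  forall i, i <= size w -> nb_factors w i = nb_factors w (size w - i).

(* The empty word is not primitive, being its own square. *)
Definition primitive (u : word) : Prop :=
  forall (v : word) (m : nat), 2 <= m -> u <> wpow v m.

Definition conjugate (u v : word) : Prop :=
  exists x y : word, u = x ++ y /\ v = y ++ x.

Definition palindrome (w : word) : Prop := w = rev w.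

(* In the product c = p ++ q the palindromes p and q may be empty; this is
   immaterial, since c is not itself a palindrome (its end letters differ). *)
Definition christoffel (c : word) : Prop :=
  c = [:: la] \/ c = [:: lb] \/
  ((exists m : word, palindrome m /\
      (c = [:: la] ++ m ++ [:: lb] \/ c = [:: lb] ++ m ++ [:: la])) /\
   (exists p q : word, palindrome p /\ palindrome q /\ c = p ++ q)).

(* Main.v *)
Require Import Defs.
From mathcomp Require Import all_boot zify.

(* Read u as an n-periodic word x and let p(i) be its number of windows of
   length i.  In u^k, a factor of length i <= N - n (N = kn) is just a window of
   length i, whereas the i + 1 factors of length N - i are pairwise distinct
   when i < n.  So u^k is factor-symmetric iff p(i) = i + 1 for all i < n.  As
   p(i) >= i + 1 by Morse-Hedlund, this is minimality of the complexity.
   On the other side, a word amb or bma is Christoffel iff exchanging its two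
   end letters yields one of its rotations, say by r.  This swap relation forces
   r to be invertible modulo n, which gives both the bound p(i) <= i + 1 and the
   palindromicity of m.  Conversely p(n - 2) = n - 1 means that one window m of
   length n - 2 occurs twice, as amb and as bma. *)

Set Implicit Arguments.
Unset Strict Implicit.
Unset Printing Implicit Defensive.

(** * Injectivity of a function on a sequence, and its failure *)

Section UniqMap.
Variables (S T : eqType) (f : S -> T).

Lemma uniq_map_inj_in (s : seq S) : uniq (map f s) -> {in s &, injective f}.
Proof.
elim: s => [//|z s IHs] /= /andP[zNs us] a b; rewrite !inE.
case/predU1P => [->|sa] /predU1P [->|sb] // eq_f.
- by case/negP: zNs; rewrite eq_f map_f.
- by case/negP: zNs; rewrite -eq_f map_f.
- exact: IHs.
Qed.

Lemma nuniq_map_iota (g : nat -> T) m : ~~ uniq (map g (iota 0 m)) ->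
  exists i j, [/\ i < m, j < m, i != j & g i = g j].
Proof.
move=> nug; have : ~~ dinjectiveb (fun i : 'I_m => g i) predT.
  rewrite /dinjectiveb; apply: contra nug.
  by rewrite -val_enum_ord -map_comp.
case/dinjectivePn => i _ [j /andP[jNi _] eq_g].
by exists i, j; split=> //; rewrite eq_sym.
Qed.

End UniqMap.

(** * Periodic words and the counting of their windows *)

Section Windows.
Implicit Types (x : nat -> letter) (q i j n r s t : nat).

Definition periodic x n := forall t, x (t + n) = x t.

Definition window x q i : word := mkseq (fun j => x (q + j)) i.

(** The bound [n] on the starting points is the period when counting for the periodic word, and
    [N - i + 1] when counting factors of a word of length [N]. *)
Definition complexity x n i := size (undup [seq window x q i | q <- iota 0 n]).

Lemma size_window x q i : size (window x q i) = i.
Proof. exact: size_mkseq. Qed.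

Lemma windowS x q i : window x q i.+1 = rcons (window x q i) (x (q + i)).
Proof. by rewrite /window /mkseq -addn1 iotaD map_cat cats1. Qed.

Lemma windowSl x q i : window x q i.+1 = x q :: window x q.+1 i.
Proof.
rewrite /window /mkseq /= addn0 (iotaDl 1 0) -map_comp.
by congr (_ :: _); apply: eq_map => j /=; rewrite addnA addn1.
Qed.

Lemma window_take x q i j : i <= j -> take i (window x q j) = window x q i.
Proof. by move=> le_ij; rewrite /window /mkseq -map_take take_iota (minn_idPl le_ij). Qed.

Lemma eq_windowP x q1 q2 i :
  window x q1 i = window x q2 i <-> forall j, j < i -> x (q1 + j) = x (q2 + j).
Proof.
split=> [eqw j ltji | eqx].
  by have := congr1 (fun v => nth false v j) eqw; rewrite !nth_mkseq.
by apply/eq_in_map => j; rewrite mem_iota => /andP[_ ltji]; exact: eqx.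
Qed.

Lemma periodicM x n k : periodic x n -> periodic x (k * n).
Proof.
move=> per; elim: k => [|k IHk] t; first by rewrite addn0.
by rewrite mulSn addnA IHk per.
Qed.

Lemma periodic_modn x n t : periodic x n -> x (t %% n) = x t.
Proof. by move=> per; rewrite {2}(divn_eq t n) addnC periodicM. Qed.

Lemma periodic_eqmod x n s t : periodic x n -> s = t %[mod n] -> x s = x t.
Proof. by move=> per eq_st; rewrite -(periodic_modn s per) eq_st periodic_modn. Qed.

Lemma window_eqmod x n q1 q2 i : periodic x n -> q1 = q2 %[mod n] ->
  window x q1 i = window x q2 i.
Proof.
move=> per eq_q; apply/eq_windowP => j _; apply: (periodic_eqmod per).
by apply/eqP; rewrite eqn_modDr; apply/eqP.
Qed.

(** Sliding by one drops [x q] and adds [x (q + n)], the same letter. The letters, read as numbers,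
    add up to the number of b's. *)
Lemma sum_periodic x n q : periodic x n -> \sum_(t < n) x (q + t) = \sum_(t < n) x t.
Proof.
move=> per; elim: q => [|q IHq]; first by apply: eq_bigr.
rewrite -IHq; case: n per {IHq} => [|n] per; first by rewrite !big_ord0.
rewrite big_ord_recr big_ord_recl /= addn0 addSnnS per addnC.
by congr (_ + _); apply: eq_bigr => t _; rewrite addSnnS.
Qed.

Lemma nb_factors_mkseq x N i : i <= N ->
  nb_factors (mkseq x N) i = complexity x (N - i).+1 i.
Proof.
move=> le_iN; rewrite /nb_factors /complexity cardE -(size_map val).
apply: perm_size; apply: uniq_perm; rewrite ?undup_uniq ?map_inj_uniq ?enum_uniq //.
  exact: val_inj.
move=> v; rewrite mem_undup; apply/mapP/mapP => [[tv]|[q]].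
  rewrite mem_enum inE => /infixP[p [s' def_w]] ->.
  have := congr1 size def_w; rewrite size_mkseq !size_cat size_tuple => szN.
  exists (size p); first by rewrite mem_iota; lia.
  apply: (@eq_from_nth _ false); rewrite ?size_tuple ?size_window // => j lt_ji.
  have := congr1 (nth false ^~ (size p + j)) def_w.
  rewrite nth_mkseq; last by lia.
  by rewrite nth_cat ltnNge leq_addr addKn nth_cat size_tuple lt_ji nth_mkseq.
rewrite mem_iota => /andP[_ lt_q] ->.
have szw : size (window x q i) == i by rewrite size_window.
exists (Tuple szw) => //; rewrite mem_enum inE; apply/infixP => /=.
exists (take q (mkseq x N)), (drop i (drop q (mkseq x N))).
have -> : window x q i = take i (drop q (mkseq x N)).
  have le_i : i <= size (drop q (mkseq x N)) by rewrite size_drop size_mkseq; lia.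
  apply: (@eq_from_nth _ false); rewrite size_window ?size_takel //.
  move=> j lt_ji; rewrite nth_take // nth_drop !nth_mkseq //; lia.
by rewrite !cat_take_drop.
Qed.

Lemma size_undup_eq_mem (s1 s2 : seq word) : s1 =i s2 -> size (undup s1) = size (undup s2).
Proof.
move=> eq_s; apply: perm_size; apply: uniq_perm; rewrite ?undup_uniq // => v.
by rewrite !mem_undup.
Qed.

Lemma complexity_ge_period x n m i : 0 < n -> periodic x n -> n <= m ->
  complexity x m i = complexity x n i.
Proof.
move=> n_gt0 per le_nm; apply: size_undup_eq_mem => v.
apply/mapP/mapP=> [] [q]; rewrite mem_iota /= => lt_q ->.
  exists (q %% n); first by rewrite mem_iota /= add0n ltn_pmod.
  by apply: (window_eqmod _ per); rewrite modn_mod.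
by exists q; rewrite // mem_iota /=; lia.
Qed.

Lemma complexity_shift x y n i d : 0 < n -> periodic x n ->
  (forall t, y t = x (t + d)) -> complexity y n i = complexity x n i.
Proof.
move=> n_gt0 per def_y; apply: size_undup_eq_mem => v.
have win q : window y q i = window x (q + d) i.
  by apply: eq_map => j /=; rewrite def_y addnAC.
apply/mapP/mapP=> [] [q]; rewrite mem_iota /= add0n => lt_q ->.
  exists ((q + d) %% n); first by rewrite mem_iota /= add0n ltn_pmod.
  by rewrite win; apply: (window_eqmod _ per); rewrite modn_mod.
(* Modulo [n], adding [n.-1 * d] amounts to subtracting [d]. *)
exists ((q + n.-1 * d) %% n); first by rewrite mem_iota /= add0n ltn_pmod.
rewrite win; apply: (window_eqmod _ per).
rewrite modnDml -addnA -mulSnr prednK // mulnC -modnDmr modnMl addn0 //.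
Qed.

(** * The Morse-Hedlund lower bound *)

Section Complexity.
Variables (x : nat -> letter) (n : nat).
Hypotheses (n_gt0 : 0 < n) (per : periodic x n).

Lemma window_inj m i : m <= i -> {in iota 0 n &, injective (fun q => window x q m)} ->
  {in iota 0 n &, injective (fun q => window x q i)}.
Proof.
move=> le_mi inj_m q1 q2 q1P q2P eqw; apply: inj_m => //=.
by rewrite -!(window_take _ _ le_mi) eqw.
Qed.

Lemma complexity_inj m i : m <= n -> {in iota 0 n &, injective (fun q => window x q i)} ->
  complexity x m i = m.
Proof.
move=> le_mn inj_i; rewrite /complexity undup_id ?size_map ?size_iota //.
rewrite map_inj_in_uniq ?iota_uniq // => q1 q2.
by rewrite !mem_iota => q1P q2P; apply: inj_i; rewrite mem_iota; lia.
Qed.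

Lemma complexity_max i : complexity x n i = n ->
  {in iota 0 n &, injective (fun q => window x q i)}.
Proof.
move=> eq_p; apply: uniq_map_inj_in; apply: negbNE; rewrite -ltn_size_undup.
by rewrite size_map size_iota -/(complexity x n i) eq_p ltnn.
Qed.

(* If the complexity does not grow at i, a window of length i
   determines its right neighbour, hence the whole word from there on. *)
Hypothesis inj_window : {in iota 0 n &, injective (fun q => window x q n)}.

Lemma complexity_grows i : complexity x n i < n ->
  complexity x n i < complexity x n i.+1.
Proof.
move=> lt_p; rewrite ltnNge; apply/negP => le_p.
pose W j := [seq window x q j | q <- iota 0 n].
have subW : {subset undup (W i) <= map (take i) (undup (W i.+1))}.
  move=> v; rewrite mem_undup => /mapP[q qP ->]; rewrite -(window_take _ _ (leqnSn i)).
  by apply: map_f; rewrite mem_undup; apply: (map_f (fun q => window x q _)).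
(* Truncation maps the windows of length [i + 1] onto those of length [i]; as the former are no more
   numerous, it is injective on them. *)
have /uniq_map_inj_in inj_take : uniq (map (take i) (undup (W i.+1))).
  by apply: leq_size_uniq subW _; rewrite ?undup_uniq // size_map.
have memW q j : window x q j \in undup (W j).
  rewrite mem_undup (@window_eqmod x n q (q %% n)) ?modn_mod //.
  by apply: (map_f (fun q => window x q _)); rewrite mem_iota /= add0n ltn_pmod.
have next q1 q2 : window x q1 i = window x q2 i -> window x q1 i.+1 = window x q2 i.+1.
  by move=> eqw; apply: inj_take; rewrite ?memW ?window_take.
have ext j q1 q2 : window x q1 i = window x q2 i -> window x q1 (i + j) = window x q2 (i + j).
  elim: j q1 q2 => [|j IHj] q1 q2 eqw; first by rewrite addn0.
  have := next _ _ eqw; rewrite addnS !windowSl => -[eqx /IHj eqw'].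
  by rewrite eqx eqw'.
suff: complexity x n i = n by move=> eq_p; rewrite eq_p ltnn in lt_p.
apply: complexity_inj => // q1 q2 q1P q2P /(ext n); apply: (window_inj _ inj_window) => //.
exact: leq_addl.
Qed.

(** The complexity is positive at [0] and grows strictly until it reaches [n], where it stays. *)
Lemma complexity_lb i : i < n -> i < complexity x n i.
Proof.
elim: i => [|i IHi] lt_in.
  have : window x 0 0 \in undup [seq window x q 0 | q <- iota 0 n].
    by rewrite mem_undup; apply: (map_f (fun q => window x q _)); rewrite mem_iota.
  by rewrite /complexity; case: (undup _).
have [lt_p|] := ltnP (complexity x n i) n.
  by have := complexity_grows lt_p; have := IHi (ltnW lt_in); lia.
move=> le_np; have eq_p : complexity x n i = n.
  by apply/eqP; rewrite eqn_leq le_np andbT (leq_trans (size_undup _)) ?size_map ?size_iota.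
by rewrite complexity_inj //; apply: window_inj (leqnSn i) (complexity_max eq_p).
Qed.
End Complexity.

(** * Periods and primitivity *)

Lemma periodic_gcdn x m n : 0 < m -> periodic x m -> periodic x n ->
  periodic x (gcdn m n).
Proof.
move=> m_gt0 perm pern t; case: (egcdnP n m_gt0) => km kn eq_g _.
by rewrite -(periodicM kn pern) -addnA [gcdn m n + _]addnC -eq_g periodicM.
Qed.

Lemma wpow_mkseq x g m : periodic x g -> wpow (mkseq x g) m = mkseq x (m * g).
Proof.
move=> per; elim: m => [//|m IHm]; rewrite /wpow /= -/(wpow _ m) IHm mulSn.
rewrite /mkseq iotaD map_cat add0n; congr (_ ++ _).
have -> : iota g (m * g) = [seq g + t | t <- iota 0 (m * g)] by rewrite -iotaDl addn0.
rewrite -map_comp.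
by apply: eq_map => t /=; rewrite addnC per.
Qed.

(** If two windows of length [n] agree, the distance of their starting points is a period. Its gcd
    with [n] is then a period that divides [n] properly, which makes the word a proper power. *)
Lemma primitive_window_inj x n : periodic x n -> primitive (mkseq x n) ->
  {in iota 0 n &, injective (fun q => window x q n)}.
Proof.
move=> per prim q1 q2; rewrite !mem_iota !add0n /=.
wlog: q1 q2 / q1 < q2.
  move=> IH lt1 lt2 eqw; case: (ltngtP q1 q2) => // lt12; first exact: IH.
  by apply/esym/IH.
move=> lt12 lt1 lt2 /eq_windowP eqx.
have n_gt0 : 0 < n by lia.
have eqx' t : x (q1 + t) = x (q2 + t).
  have eqm q : x (q + t) = x (q + t %% n).
    by apply: (periodic_eqmod per); rewrite modnDmr.
  by rewrite !eqm eqx // ltn_pmod.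
have perd : periodic x (q2 - q1).
  (* Adding [q1 * n], a multiple of the period, makes room for stepping back by [q1]. *)
  move=> t; rewrite -(periodicM q1 per) -[RHS](periodicM q1 per).
  have le : q1 <= q1 * n by rewrite leq_pmulr.
  have := eqx' (t + (q1 * n - q1)).
  have -> : q1 + (t + (q1 * n - q1)) = t + q1 * n by lia.
  by have -> : q2 + (t + (q1 * n - q1)) = t + (q2 - q1) + q1 * n by lia.
have d_gt0 : 0 < q2 - q1 by rewrite subn_gt0.
have perg := periodic_gcdn d_gt0 perd per.
set g := gcdn _ _ in perg.
have lt_gn : g < n by apply: leq_ltn_trans (dvdn_leq d_gt0 (dvdn_gcdl _ _)) _; lia.
have g_gt0 : 0 < g by rewrite gcdn_gt0 d_gt0.
have /dvdnP[m def_n] : g %| n by apply: dvdn_gcdr.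
case: (prim (mkseq x g) m); last by rewrite wpow_mkseq // -def_n.
by case: m def_n => [|[|m]]; lia.
Qed.

(** * Words in which a rotation exchanges the two end letters *)

Definition at_end n t := (n %| t) || (n %| t.+1).

Lemma at_endE n t : 0 < n -> at_end n t = (t %% n == 0) || (t %% n == n.-1).
Proof.
move=> n_gt0; rewrite /at_end /dvdn -(addn1 t) -modnDml addn1.
congr (_ || _); have := ltn_pmod t n_gt0; move: (t %% n) => s lt_sn.
have [-> | neq] := eqVneq s n.-1; first by rewrite prednK // modnn.
by rewrite modn_small //; lia.
Qed.

(** Modulo [n], [s] is the reflection [n - 1 - t] of [t], which exchanges the two ends. *)
Lemma at_end_opp n s t : n %| s + t.+1 -> at_end n s = at_end n t.
Proof.
move=> dvd; rewrite /at_end orbC; congr (_ || _).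
  rewrite -addSnnS in dvd.
  by apply/idP/idP => d; move: dvd; rewrite ?(dvdn_addr _ d) ?(dvdn_addl _ d).
by apply/idP/idP => d; move: dvd; rewrite ?(dvdn_addr _ d) ?(dvdn_addl _ d).
Qed.

Section Swap.
Variables (x : nat -> letter) (n r : nat).
Hypotheses (n_gt1 : 1 < n) (per : periodic x n) (x_ends : x n.-1 = ~~ x 0).
Hypothesis swap : forall t, x (t + r) = x t (+) at_end n t.

Let n_gt0 : 0 < n := ltnW n_gt1.

(* Along the orbit 0, r, 2r, ... modulo n the letter changes at 0 and can only
   change back at n - 1. *)
Lemma swap_shift : exists j, n %| (j * r).+1.
Proof.
have ex_end : exists j, (0 < j) && at_end n (j * r).
  by exists n; rewrite n_gt0 /at_end dvdn_mulr.
case: (ex_minnP ex_end) => j /andP[j_gt0 end_j] min_j.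
exists j; case/orP: end_j => // n_jr.
(* Suppose the orbit is back at [0] before it meets [n - 1]. The letter, flipped by the first step,
   meets no end in between and would still be flipped at [0]. *)
have x_i i : 0 < i <= j -> x (i * r) = ~~ x 0.
  elim: i => [//|[|i] IHi] /andP[_ le_ij].
    by rewrite mul1n -(add0n r) swap /at_end dvdn0 addbT.
  rewrite mulSnr swap IHi ?(ltnW le_ij) //.
  have -> : at_end n (i.+1 * r) = false.
    by apply/negbTE/negP => end_i; have := min_j i.+1 end_i; lia.
  by rewrite addbF.
have := x_i j; rewrite j_gt0 leqnn => /(_ isT).
rewrite (@periodic_eqmod x n _ 0) //; first by case: (x 0).
by apply/eqP; rewrite mod0n.
Qed.

(** As [j * r] is -1 modulo [n], [t * j] steps by [r] lead from [t] to [0]. The number of these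
    steps serves as induction measure below. *)
Lemma swap_reach t : exists i, n %| t + i * r.
Proof.
have [j n_j] := swap_shift; exists (t * j).
by rewrite -mulnA -mulnS dvdn_mull.
Qed.

(** When [t] moves forward by [r], its reflection [s] moves back by [r]. The flips at [s'] and
    [t + r] cancel, so the claim passes from [t + r] to [t]; for [t = 0] it is [x_ends]. *)
Lemma swap_pal s t : n %| s + t.+1 -> x s = x t (+) at_end n t.
Proof.
have [i n_i] := swap_reach t; elim: i t n_i s => [|i IHi] t n_i s n_st.
  rewrite mul0n addn0 in n_i.
  have -> : x t = x 0 by apply: (periodic_eqmod per); apply/eqP; rewrite mod0n.
  rewrite /at_end n_i addbT -x_ends; apply: (periodic_eqmod per).
  apply/eqP; rewrite -(eqn_modDr 1) !addn1 prednK // modnn.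
  by rewrite -addSnnS dvdn_addl in n_st.
rewrite mulSn addnA in n_i.
pose s' := s + n.-1 * r.
have n_s't : n %| s' + (t + r).+1.
  have -> : s' + (t + r).+1 = s + t.+1 + n * r by rewrite /s'; nia.
  by rewrite dvdn_addr // dvdn_mulr.
have eq_s : x s = x (s' + r).
  apply: (periodic_eqmod per).
  have -> : s' + r = r * n + s by rewrite /s'; nia.
  by rewrite modnMDl.
by rewrite eq_s swap (IHi _ n_i _ n_s't) swap (at_end_opp n_s't) -addbA addbb addbF.
Qed.

(* A window of length i keeps its value when moved by r, unless it meets one
   of the swapped positions; this leaves only i + 1 starting points. *)
Lemma swap_complexity i : i < n -> complexity x n i <= i.+1.
Proof.
(* Windows starting at [n - i], ..., [n - 1] reach position [n - 1]; the last starting point, [n],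
   stands for [0]. *)
move=> lt_in; pose W := [seq window x q i | q <- iota (n - i) i.+1].
have memW q : window x q i \in W.
  have [m n_m] := swap_reach q; elim: m q n_m => [|m IHm] q n_m.
    rewrite mul0n addn0 in n_m; apply/mapP; exists n; first by rewrite mem_iota; lia.
    by apply: (window_eqmod _ per); rewrite modnn; apply/eqP.
  have [q_small|q_large] := ltnP (q %% n) (n - i).
    have [q0|qN0] := eqVneq (q %% n) 0.
      apply/mapP; exists n; first by rewrite mem_iota; lia.
      by apply: (window_eqmod _ per); rewrite modnn.
    have <- : window x (q + r) i = window x q i.
      apply/eq_windowP => j lt_ji; rewrite addnAC swap at_endE //.
      rewrite -modnDml modn_small; last by lia.
      by case: eqP => [|_]; [lia|case: eqP => [|_]; [lia|rewrite addbF]].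
    by apply: IHm; rewrite -addnA -mulSn.
  apply/mapP; exists (q %% n).
    by rewrite mem_iota; have := ltn_pmod q n_gt0; lia.
  by apply: (window_eqmod _ per); rewrite modn_mod.
rewrite -[i.+1](size_iota (n - i)) -(size_map (fun q => window x q i)).
apply: uniq_leq_size; first exact: undup_uniq.
by move=> v; rewrite mem_undup => /mapP[q _ ->].
Qed.

End Swap.

(** * Finite words extended periodically *)

Definition cyc (u : word) t : letter := nth false u (t %% size u).

Lemma cyc_periodic u : periodic (cyc u) (size u).
Proof. by move=> t; rewrite /cyc modnDr. Qed.

Lemma mkseq_cyc u : mkseq (cyc u) (size u) = u.
Proof.
apply: (@eq_from_nth _ false); rewrite size_mkseq // => t lt_t.
by rewrite nth_mkseq // /cyc modn_small.
Qed.

Lemma window_cyc u q : window (cyc u) q (size u) = rot (q %% size u) u.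
Proof.
apply: (@eq_from_nth _ false); rewrite size_window ?size_rot // => t lt_t.
have := ltn_pmod q (leq_ltn_trans (leq0n _) lt_t) => lt_q.
rewrite nth_mkseq // nth_cat size_drop nth_drop /cyc -modnDml.
case: ltnP => [lt_tq|le_tq]; first by rewrite modn_small //; lia.
rewrite nth_take; last by lia.
have -> : q %% size u + t = t - (size u - q %% size u) + size u by lia.
by rewrite modnDr modn_small //; lia.
Qed.

Lemma cyc_rot u d t : d <= size u -> cyc (rot d u) t = cyc u (t + d).
Proof.
rewrite leq_eqVlt => /predU1P [->|lt_d]; first by rewrite rot_size cyc_periodic.
have u_gt0 : 0 < size u by apply: leq_ltn_trans lt_d.
rewrite -{1}(modn_small lt_d) -window_cyc {1}/cyc size_window nth_mkseq ?ltn_pmod //.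
by apply: (periodic_eqmod (@cyc_periodic u)); rewrite modnDmr addnC.
Qed.

(** * Christoffel words and the swap relation *)

Lemma cyc_swap_ends z m t :
  cyc ([:: ~~ z] ++ m ++ [:: z]) t =
  cyc ([:: z] ++ m ++ [:: ~~ z]) t (+) at_end (size m).+2 t.
Proof.
have sz y y' : size ([:: y] ++ m ++ [:: y']) = (size m).+2.
  by rewrite /= size_cat addn1.
rewrite /cyc !sz at_endE //; have := ltn_pmod t (ltn0Sn (size m).+1).
case: (t %% _) => [|s] lt_s; first by rewrite addbT.
rewrite /= !nth_cat eqSS; case: (ltngtP s (size m)) => [_|lt|->].
- by rewrite addbF.
- by lia.
by rewrite subnn /= addbT negbK.
Qed.

Lemma conjugate_rot (u v : word) : conjugate u v <-> exists2 d, d <= size u & v = rot d u.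
Proof.
split=> [[y [z [-> ->]]] | [d le_d ->]].
  by exists (size y); rewrite ?rot_size_cat // size_cat leq_addr.
by exists (take d u), (drop d u); rewrite cat_take_drop.
Qed.

(* Both palindromes together say that reversing c, which swaps its end
   letters, is the same as rotating it by the length of p. *)
Lemma christoffel_swap c : 1 < size c -> christoffel c ->
  cyc c (size c).-1 = ~~ cyc c 0 /\
  exists r, forall t, cyc c (t + r) = cyc c t (+) at_end (size c) t.
Proof.
move=> c_gt1 [def_c|[def_c|[[m [pal_m def_c]] [p [q [pal_p [pal_q c_pq]]]]]]].
- by rewrite def_c in c_gt1.
- by rewrite def_c in c_gt1.
have {}def_c : exists z, c = [:: z] ++ m ++ [:: ~~ z].
  by case: def_c => ->; [exists false | exists true].
case: def_c => z def_c.
have szc : size c = (size m).+2 by rewrite def_c /= size_cat addn1.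
have rev_c : rev c = [:: ~~ z] ++ m ++ [:: z].
  by rewrite def_c !rev_cat -pal_m -catA.
split.
  rewrite /cyc mod0n modn_small ?prednK ?(ltnW c_gt1) // szc def_c /=.
  by rewrite nth_cat ltnn subnn.
exists (size p) => t; rewrite -cyc_rot; last by rewrite c_pq size_cat leq_addr.
have -> : rot (size p) c = rev c.
  by rewrite c_pq rot_size_cat rev_cat -pal_p -pal_q.
by rewrite rev_c cyc_swap_ends -def_c szc.
Qed.

(** By [swap_pal], reversing [c] changes exactly its two ends, and so does rotating it by [r]. Hence
    both agree, and comparing them piecewise gives the two palindromes. *)
Lemma swap_christoffel x n r : 1 < n -> periodic x n -> x n.-1 = ~~ x 0 ->
  (forall t, x (t + r) = x t (+) at_end n t) -> christoffel (mkseq x n).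
Proof.
move=> n_gt1 per x_ends swap; set c := mkseq x n.
have szc : size c = n by apply: size_mkseq.
have n_gt0 := ltnW n_gt1.
have rev_c : rev c = rot (r %% n) c.
  apply: (@eq_from_nth _ false); rewrite size_rev ?size_rot // szc => t lt_t.
  rewrite nth_rev szc // nth_mkseq; last by lia.
  have def_c : cyc c =1 x.
    by move=> s; rewrite /cyc szc nth_mkseq ?ltn_pmod // periodic_modn.
  rewrite -{2}szc -window_cyc nth_mkseq ?szc // def_c addnC swap.
  by apply: (swap_pal n_gt1 per x_ends swap); rewrite subnK.
have pal_ends : exists m, palindrome m /\ c = [:: x 0] ++ m ++ [:: ~~ x 0].
  exists (window x 1 n.-2); split.
    apply: (@eq_from_nth _ false); rewrite ?size_rev size_window // => t lt_t.
    rewrite nth_rev ?size_window // !nth_mkseq //; last by lia.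
    rewrite (@swap_pal x n r n_gt1 per x_ends swap _ (1 + (n.-2 - t.+1))).
      by rewrite at_endE // modn_small; [rewrite [_ || _](_ : _ = false) ?addbF|]; lia.
    by rewrite (_ : 1 + t + _ = n) //; lia.
  rewrite -x_ends cat1s cats1.
  have -> : c = window x 0 n.-2.+2 by rewrite !prednK //; lia.
  by rewrite windowSl windowS; congr (_ :: rcons _ (x _)); lia.
right; right; split.
  case: pal_ends => m [pal_m def_c]; exists m; split=> //.
  by rewrite def_c; case: (x 0); [right|left].
exists (take (r %% n) c), (drop (r %% n) c).
move: rev_c; rewrite -{1}(cat_take_drop (r %% n) c) rev_cat => /eqP.
rewrite eqseq_cat ?size_rev // => /andP[/eqP pal_q /eqP pal_p].
by rewrite cat_take_drop /palindrome pal_q pal_p.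
Qed.

(* Some window of length n - 2 starts at two positions.  Having distinct
   extensions on each side, it gives two rotations of x that differ exactly at
   both ends; as they have the same number of b's, their ends are amb and bma. *)
Lemma complexity_swap x n : 1 < n -> periodic x n ->
  {in iota 0 n &, injective (fun q => window x q n)} ->
  complexity x n n.-2 = n.-1 ->
  exists q r, x (q + n.-1) = ~~ x q /\
    forall t, x (q + (t + r)) = x (q + t) (+) at_end n t.
Proof.
move=> n_gt1 per inj eq_p; have n_gt0 := ltnW n_gt1.
have : ~~ uniq [seq window x q n.-2 | q <- iota 0 n].
  by rewrite -ltn_size_undup -/(complexity x n n.-2) eq_p size_map size_iota prednK.
case/nuniq_map_iota => i [j [lt_in lt_jn neq_ij eqw]].
(* By Morse-Hedlund, there are at least [n] windows of length [n - 1], so no two of the [n] starting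
   points share one. *)
have inj1 : {in iota 0 n &, injective (fun q => window x q n.-1)}.
  apply: complexity_max; apply/eqP; rewrite eqn_leq.
  rewrite (leq_trans (size_undup _)) ?size_map ?size_iota //=.
  by have := complexity_lb n_gt0 per inj (_ : n.-1 < n); rewrite prednK //; apply; lia.
have inj_mod q1 q2 : window x q1 n.-1 = window x q2 n.-1 -> q1 = q2 %[mod n].
  rewrite -(@window_eqmod x n (q1 %% n) q1) ?modn_mod //.
  rewrite -(@window_eqmod x n (q2 %% n) q2) ?modn_mod // => eqw12.
  by apply: (inj1 _ _ _ _ eqw12); rewrite mem_iota ltn_pmod.
have neq_mod k : i + k <> j + k %[mod n].
  by move/eqP; rewrite eqn_modDr !modn_small // (negbTE neq_ij).
have n_1 : n.-1 = n.-2.+1 by lia.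
(* Modulo [n], these are the positions just before [i] and [j]. *)
pose q := i + n.-1; pose q' := j + n.-1.
have shift k : window x (k + n.-1).+1 n.-2 = window x k n.-2.
  by apply: (window_eqmod _ per); rewrite -addnS prednK // modnDr.
have eq_mid t : t < n.-2 -> x (q'.+1 + t) = x (q.+1 + t).
  by move: t; apply/eq_windowP; rewrite !shift.
have neqP (y z : letter) : y <> z -> y = ~~ z by case: y; case: z.
have neq_first : x q' = ~~ x q.
  apply: neqP => eqx; apply: (neq_mod n.-1); apply: inj_mod.
  by rewrite n_1 !windowSl -n_1 -/q -/q' eqx !shift eqw.
have neq_last : x (q' + n.-1) = ~~ x (q + n.-1).
  apply: neqP => eqx; apply: (neq_mod n); apply: inj_mod.
  rewrite -(prednK n_gt0) !addnS -/q -/q' [in LHS]n_1 [in RHS]n_1 !windowS !shift eqw.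
  by rewrite !addSnnS -n_1 eqx.
(* Were the two end letters equal, flipping both would change the number of b's by two. *)
have ends : x (q + n.-1) = ~~ x q.
  have : \sum_(t < n) x (q + t) = \sum_(t < n) x (q' + t) by rewrite !sum_periodic.
  have sum_n k : \sum_(t < n) x (k + t) =
      x k + (\sum_(t < n.-2) x (k.+1 + t) + x (k + n.-1)).
    have -> : n = n.-2.+2 by lia.
    rewrite big_ord_recl big_ord_recr /= addn0; congr (_ + (_ + _)).
    by apply: eq_bigr => t _; rewrite addSnnS.
  rewrite !sum_n neq_first neq_last.
  rewrite [in RHS](eq_bigr (fun t : 'I__ => x (q.+1 + t) : nat)) => [|t _]; last by rewrite eq_mid.
  by case: (x q); case: (x (q + _)) => //=; lia.
have swap_lt t : t < n -> x (q' + t) = x (q + t) (+) at_end n t.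
  move=> lt_tn; rewrite at_endE // modn_small //.
  case: t lt_tn => [|t] lt_tn; first by rewrite !addn0 addbT.
  have [->|neq_t] := eqVneq t.+1 n.-1; first by rewrite orbT addbT.
  by rewrite addbF -!addSnnS eq_mid //; lia.
(* The rotation is by [q' - q] modulo [n]. *)
exists q, (q' + n.-1 * q); split=> // t.
have -> : x (q + (t + (q' + n.-1 * q))) = x (q' + t %% n).
  apply: (periodic_eqmod per); rewrite modnDmr.
  have -> : q + (t + (q' + n.-1 * q)) = q * n + (q' + t) by nia.
  by rewrite modnMDl.
have -> : x (q + t) = x (q + t %% n) by apply: (periodic_eqmod per); rewrite modnDmr.
by rewrite swap_lt ?ltn_pmod // !at_endE // modn_mod.
Qed.

(** * Factor symmetry of powers in terms of complexity *)

Lemma factor_symmetric_wpow (u : word) k : primitive u -> 1 < k ->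
  factor_symmetric (wpow u k) <->
  forall i, i < size u -> complexity (cyc u) (size u) i = i.+1.
Proof.
move=> prim k_gt1; set n := size u; set x := cyc u.
have n_gt0 : 0 < n by rewrite lt0n size_eq0; apply/eqP => /(prim [::] 2 isT).
have per : periodic x n := @cyc_periodic u.
have inj : {in iota 0 n &, injective (fun q => window x q n)}.
  by apply: primitive_window_inj; rewrite // mkseq_cyc.
have def_w : wpow u k = mkseq x (k * n) by rewrite -wpow_mkseq // mkseq_cyc.
have le2n : n + n <= k * n by rewrite addnn -mul2n leq_mul2r k_gt1 orbT.
rewrite /factor_symmetric def_w size_mkseq; move: (k * n) le2n => N le2n {def_w}.
have nb_short i : i <= N - n -> nb_factors (mkseq x N) i = complexity x n i.
  by move=> le_i; rewrite nb_factors_mkseq ?(complexity_ge_period _ n_gt0 per) //; lia.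
have nb_long i : i < n -> nb_factors (mkseq x N) (N - i) = i.+1.
  move=> lt_in; rewrite nb_factors_mkseq ?leq_subr // subKn; last by lia.
  by apply: (@complexity_inj x n) => //; apply: (window_inj _ inj); lia.
split=> [sym i lt_in | cplx i le_iN].
  by rewrite -(nb_long i lt_in) -nb_short ?(sym i) //; lia.
(* As [N >= 2n], at most one of [i] and [N - i] is below [n]; if neither is, both counts equal
   [n]. *)
have [lt_in|le_ni] := ltnP i n; first by rewrite nb_long // nb_short ?cplx //; lia.
have [lt_Nin|le_nNi] := ltnP (N - i) n.
  by rewrite -{1}(subKn le_iN) nb_long // nb_short ?cplx //; lia.
by rewrite !nb_short; try lia; rewrite !(@complexity_inj x n) //; apply: (window_inj _ inj).
Qed.

End Windows.

Theorem theorem6 (u : word) (k : nat) (hu : primitive u) (hk : 2 <= k) :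
  factor_symmetric (wpow u k) <->
  exists c : word, christoffel c /\ conjugate u c.
Proof.
rewrite factor_symmetric_wpow //; set n := size u; set x := cyc u.
have n_gt0 : 0 < n by rewrite lt0n size_eq0; apply/eqP => /(hu [::] 2 isT).
have per : periodic x n := @cyc_periodic u.
have inj : {in iota 0 n &, injective (fun q => window x q n)}.
  by apply: primitive_window_inj; rewrite // mkseq_cyc.
(* The swap relation is used for two distinct ends only; a single letter is itself a Christoffel
   word. *)
have [n_gt1|n_le1] := ltnP 1 n; last first.
  have n1 : n = 1 by apply/eqP; rewrite eqn_leq n_le1.
  split=> _; last first.
    move=> i lt_in; apply/eqP; rewrite eqn_leq complexity_lb // andbT.
    by rewrite (leq_trans (size_undup _)) // size_map size_iota n1.
  exists u; split; last by exists [::], u; rewrite cats0.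
  by move: n1; rewrite /n; case: (u) => [|[] [|]] // _; [right; left | left].
split=> [cplx | [c [chr_c /conjugate_rot [d le_dn def_c]]] i lt_in].
  have [|q [r [ends swap]]] := complexity_swap n_gt1 per inj.
    by rewrite cplx; lia.
  exists (window x q n); split.
    apply: (swap_christoffel (r := r)) => //; first by move=> t; rewrite addnA per.
    by rewrite addn0.
  apply/conjugate_rot; exists (q %% n); last exact: window_cyc.
  by rewrite ltnW // ltn_pmod.
have szc : size c = n by rewrite def_c size_rot.
have [|ends [r swap]] := christoffel_swap _ chr_c; first by rewrite szc.
have def_y t : cyc c t = x (t + d) by rewrite def_c cyc_rot.
(* The upper bound is proved for [c], whose periodic word is a shift of [x] and has the same
   windows. *)
apply/eqP; rewrite eqn_leq complexity_lb // andbT.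
rewrite -(complexity_shift _ n_gt0 per def_y).
rewrite szc in ends swap.
by apply: (swap_complexity n_gt1 _ ends swap lt_in); rewrite -szc; apply: cyc_periodic.
Qed.
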